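(* For each integer $m>1$, the smooth manifold underlying the real Lie group $(SL(2m-1,\mathbb{C}))^{\mathbb{R}}$ admits homogeneous (i.e. left invariant) complex product structures.
   Context: Let $M$ be a smooth manifold with tangent bundle $TM$. An almost product structure on $M$ is a smooth fibrewise linear involution $P:TM\to TM$ ($P^2=\mathrm{Id}$) of constant trace; it is a product structure if it is integrable, i.e. $N_P(X,Y)=[P(X),P(Y)]+[X,Y]-P([P(X),Y])-P([X,P(Y)])=0$ for all vector fields $X,Y$ on $M$. A complex structure is a smooth fibrewise linear $J:TM\to TM$ with $J^2=-\mathrm{Id}$ which is integrable, i.e. $N_J(X,Y)=[J(X),J(Y)]-[X,Y]-J([J(X),Y])-J([X,J(Y)])=0$ for all vector fields $X,Y$. A complex product structure on $M$ is a couple $(P,J)$ where $P$ is a product structure, $J$ is a complex structure, and $PJ=-JP$. A complex product structure on a Lie group $G$ is homogeneous, or (left) invariant, if all left translations of $G$ preserve both $P$ and $J$. $(SL(2m-1,\mathbb{C}))^{\mathbb{R}}$ denotes $SL(2m-1,\mathbb{C})$ regarded as a real Lie group. *)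

(* Defs.v *)
From HB Require Import structures.
From mathcomp Require Import all_boot all_order all_algebra.
From mathcomp Require Import complex.
From mathcomp Require Import all_classical all_reals all_analysis.

Set Implicit Arguments.
Unset Strict Implicit.
Unset Printing Implicit Defensive.

Import Order.TTheory GRing.Theory Num.Theory.
Import numFieldNormedType.Exports.

Local Open Scope classical_set_scope.
Local Open Scope ring_scope.

(* Smooth submanifolds of a finite-dimensional real normed space V are
   represented by their underlying sets M : set V.  The definitions below are
   the standard extrinsic ones, and are meant for embedded submanifolds
   (SL(n, C) in the space of n x n complex matrices is one). *)

Section Smoothness.
Context {R : realType} {V W : normedModType R}.

(* In finite dimension, f is C^(k+1) on an open set iff it is differentiable
   there and all its directional derivatives are C^k. *)
Fixpoint Ck (k : nat) (U : set V) (f : V -> W) : Prop :=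
  if k is k'.+1 then
    (forall x, U x -> differentiable f x) /\
    (forall v : V, Ck k' U (fun x => 'D_v f x))
  else forall x, U x -> {for x, continuous f}.

Definition Cinf (U : set V) (f : V -> W) : Prop := forall k, Ck k U f.

Definition local_extension (M : set V) (f : V -> W) (x : V) (F : V -> W) :=
  exists U : set V, [/\ open U, U x, Cinf U F &
    forall y, M y -> U y -> F y = f y].

(* Only the values of f on M matter. *)
Definition smooth_map (M : set V) (f : V -> W) : Prop :=
  forall x, M x -> exists F, local_extension M f x F.

(* The differential at x of a smooth map f on M, as a map on the tangent space
   of M at x; for tangent v it does not depend on the chosen extension. *)
Definition tangent_diff (M : set V) (f : V -> W) (x v : V) : W :=
  'D_v (get (local_extension M f x)) x.

End Smoothness.

Section TangentBundle.
Context {R : realType} {V : normedModType R}.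
Implicit Types (M : set V) (P J : V * V -> V * V) (X Y : V -> V).

(* Velocities at x of smooth curves in M *)
Definition tangent M (x : V) : set V := [set v |
  exists (c : R -> V) (I : set R),
    [/\ open I, I 0, Cinf I c, (forall t, I t -> M (c t)) &
        c 0 = x /\ (c^`())%classic 0 = v]].

Definition tangent_bundle M : set (V * V) :=
  [set p | M p.1 /\ tangent M p.1 p.2].

Definition tangent_map M (f : V -> V) (p : V * V) : V * V :=
  (f p.1, tangent_diff M f p.1 p.2).

Definition vector_field M X : Prop :=
  smooth_map M X /\ forall x, M x -> tangent M x (X x).

(* [X, Y] = dY(X) - dX(Y), the coordinate formula for the Lie bracket *)
Definition lie_bracket M X Y : V -> V :=
  fun x => tangent_diff M Y x (X x) - tangent_diff M X x (Y x).

Definition bundle_endomorphism M P : Prop :=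
  [/\ smooth_map (tangent_bundle M) P,
      (forall p, tangent_bundle M p ->
         tangent_bundle M (P p) /\ (P p).1 = p.1) &
      (forall x (a : R) v w, M x -> tangent M x v -> tangent M x w ->
         (P (x, a *: v + w)).2 = a *: (P (x, v)).2 + (P (x, w)).2)].

Definition act_field P X : V -> V := fun x => (P (x, X x)).2.

Definition is_basis (T : set V) (d : nat) (b : 'I_d -> V) : Prop :=
  (forall v, T v <-> exists c : 'I_d -> R, v = \sum_i c i *: b i) /\
  (forall c : 'I_d -> R, \sum_i c i *: b i = 0 -> forall i, c i = 0).

Definition has_trace (T : set V) (f : V -> V) (t : R) : Prop :=
  exists (d : nat) (b : 'I_d -> V) (A : 'M[R]_d),
    [/\ is_basis T b, (forall j, f (b j) = \sum_i A i j *: b i) & \tr A = t].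

Definition almost_product_structure M P : Prop :=
  [/\ bundle_endomorphism M P,
      (forall p, tangent_bundle M p -> P (P p) = p) &
      (exists t : R, forall x, M x ->
         has_trace (tangent M x) (fun v => (P (x, v)).2) t)].

Definition product_structure M P : Prop :=
  almost_product_structure M P /\
  forall X Y, vector_field M X -> vector_field M Y -> forall x, M x ->
    lie_bracket M (act_field P X) (act_field P Y) x + lie_bracket M X Y x
    - act_field P (lie_bracket M (act_field P X) Y) x
    - act_field P (lie_bracket M X (act_field P Y)) x = 0.

Definition almost_complex_structure M J : Prop :=
  bundle_endomorphism M J /\
  forall p, tangent_bundle M p -> J (J p) = (p.1, - p.2).

Definition complex_structure M J : Prop :=
  almost_complex_structure M J /\
  forall X Y, vector_field M X -> vector_field M Y -> forall x, M x ->
    lie_bracket M (act_field J X) (act_field J Y) x - lie_bracket M X Y x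
    - act_field J (lie_bracket M (act_field J X) Y) x
    - act_field J (lie_bracket M X (act_field J Y)) x = 0.

Definition complex_product_structure M P J : Prop :=
  [/\ product_structure M P, complex_structure M J &
      forall x v, M x -> tangent M x v ->
        (P (J (x, v))).2 = - (J (P (x, v))).2].

Definition preserves M (f : V -> V) P : Prop :=
  forall p, tangent_bundle M p ->
    P (tangent_map M f p) = tangent_map M f (P p).

(* mul is the multiplication of a Lie group with underlying manifold G. *)
Definition left_invariant (G : set V) (mul : V -> V -> V) P : Prop :=
  forall h, G h -> preserves G (mul h) P.

End TangentBundle.

Section SpecialLinear.
Context (R : realType) (n : nat).

(* The complex matrix A + i B is represented by the pair (A, B), so that the
   matrix space is a real normed space. *)
Definition cmatrix : normedModType R := ('M[R]_n * 'M[R]_n)%type.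

Definition to_complex (g : cmatrix) : 'M[R[i]]_n :=
  \matrix_(i, j) (g.1 i j +i* g.2 i j)%C.

Definition of_complex (A : 'M[R[i]]_n) : cmatrix :=
  (\matrix_(i, j) complex.Re (A i j), \matrix_(i, j) complex.Im (A i j)).

Definition SLC : set cmatrix := [set g | \det (to_complex g) = 1].

Definition cmul (g h : cmatrix) : cmatrix :=
  of_complex (to_complex g *m to_complex h).

End SpecialLinear.

Arguments SLC : clear implicits.

(* Main.v *)
From HB Require Import structures.
Require Import Defs.
From mathcomp Require Import all_boot all_order all_algebra.
From mathcomp Require Import perm complex ring.
From mathcomp Require Import all_classical all_reals all_analysis.

Set Implicit Arguments.
Unset Strict Implicit.
Unset Printing Implicit Defensive.

Import Order.TTheory GRing.Theory Num.Theory.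
Import numFieldNormedType.Exports.

Local Open Scope classical_set_scope.
Local Open Scope ring_scope.

(* Write n = 2k + 1. Modulo scalars a matrix of size 1 + 2k is X = (0, r; c, A),
   and for every matrix T of size 2k with T^2 = e (a scalar) the linear map
   twist T : X |-> (0, r T; - T c, A T) satisfies twist T^2 = e and has
   vanishing Nijenhuis tensor: this holds for right multiplication by T on the
   left ideal of matrices with zero first column, and the sign in - T c is
   forced by the brackets of that ideal with the first column. Anticommuting T's
   give anticommuting twists, so left translating the twists of T = diag(1, -1)
   and T = (0, -1; 1, 0) yields P and J. On left trivialized vector fields y |->
   y a(y) all derivative terms cancel in the Nijenhuis tensor, and only the one
   on the Lie algebra sl(n, C) remains. *)

(** * The commutator of matrices *)

Section Bracket.
Context {F : comNzRingType} {n : nat}.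
Implicit Types X Y Z : 'M[F]_n.

Definition bracket X Y := X *m Y - Y *m X.

Lemma bracket_scalarl z X : bracket z%:M X = 0.
Proof. by rewrite /bracket scalar_mxC subrr. Qed.

Lemma bracketDl X Y Z : bracket (X + Y) Z = bracket X Z + bracket Y Z.
Proof. by rewrite /bracket mulmxDl mulmxDr; apply/matrixP => i j; rewrite !mxE; ring. Qed.

Lemma bracket_anti X Y : bracket X Y = - bracket Y X.
Proof. by rewrite /bracket opprB. Qed.

Lemma bracketDr X Y Z : bracket X (Y + Z) = bracket X Y + bracket X Z.
Proof. by rewrite !(bracket_anti X) bracketDl opprD. Qed.

Lemma bracket_scalarr z X : bracket X z%:M = 0.
Proof. by rewrite bracket_anti bracket_scalarl oppr0. Qed.

Lemma tr_bracket X Y : \tr (bracket X Y) = 0.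
Proof. by rewrite /bracket linearB /= mxtrace_mulC subrr. Qed.

End Bracket.

(** * Twists of sl(1 + q): square, Nijenhuis tensor, anticommutation *)

Section Twist.
Context {F : numFieldType} {q : nat}.
Implicit Types (T S A B : 'M[F]_q) (X Y : 'M[F]_(1 + q)).

(* X 0 0 is subtracted in the last block so that scalar matrices are sent to 0. *)
Definition pretwist T X : 'M[F]_(1 + q) :=
  block_mx 0 (ursubmx X *m T) (- (T *m dlsubmx X))
           ((drsubmx X - (X 0 0)%:M) *m T).

(** The projection onto sl along the scalar matrices; it turns an endomorphism defined modulo
    scalars into one of sl. *)
Definition traceless X := X - (\tr X / (1 + q)%:R)%:M.

Definition twist T X : 'M[F]_q.+1 := traceless (pretwist T X).

Lemma block_const (z : F) : z%:M = block_mx z%:M 0 0 z%:M :> 'M[F]_(1 + q).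
Proof. exact: scalar_mx_block. Qed.

Lemma pretwist_linear T : linear (pretwist T).
Proof.
move=> z X Y; rewrite /pretwist [RHS](_ : _ = block_mx (z *: 0 + 0)
  (z *: (ursubmx X *m T) + ursubmx Y *m T)
  (z *: - (T *m dlsubmx X) - T *m dlsubmx Y)
  (z *: ((drsubmx X - (X 0 0)%:M) *m T) + (drsubmx Y - (Y 0 0)%:M) *m T)).
  congr block_mx.
  - by rewrite scaler0 addr0.
  - rewrite scalemxAl -mulmxDl; congr (_ *m _).
    by apply/matrixP => i j; rewrite !mxE.
  - rewrite -!mulmxN scalemxAr -mulmxDr; congr (_ *m _).
    by apply/matrixP => i j; rewrite !mxE opprD mulrN.
  - rewrite scalemxAl -mulmxDl; congr (_ *m _).
    by apply/matrixP => i j; rewrite !mxE; ring.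
by rewrite scale_block_mx add_block_mx.
Qed.
HB.instance Definition _ T :=
  GRing.isLinear.Build F 'M[F]_(1 + q) 'M[F]_(1 + q) _ (pretwist T) (pretwist_linear T).

Lemma traceless_linear : linear traceless.
Proof.
move=> z X Y; rewrite /traceless mxtraceD mxtraceZ.
by apply/matrixP => i j; rewrite !mxE; ring.
Qed.
HB.instance Definition _ :=
  GRing.isLinear.Build F 'M[F]_(1 + q) 'M[F]_(1 + q) _ traceless traceless_linear.

Lemma twist_linear T : linear (twist T).
Proof. by move=> z X Y; rewrite /twist linearP linearP. Qed.
HB.instance Definition _ T :=
  GRing.isLinear.Build F 'M[F]_q.+1 'M[F]_q.+1 _ (twist T) (twist_linear T).

Lemma tr_traceless X : \tr (traceless X) = 0.
Proof.
by rewrite /traceless linearB /= mxtrace_scalar -[X in _ - X]mulr_natr divfK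
  ?subrr ?pnatr_eq0//.
Qed.

Lemma traceless_id X : \tr X = 0 -> traceless X = X.
Proof. by move=> X0; rewrite /traceless X0 mul0r raddf0 subr0. Qed.

Lemma traceless_scalar z : traceless z%:M = 0.
Proof.
by rewrite /traceless mxtrace_scalar -(mulr_natr z) mulfK ?subrr ?pnatr_eq0//.
Qed.

Lemma tr_twist T X : \tr (twist T X) = 0.
Proof. exact: tr_traceless. Qed.

Lemma pretwist_scalar T z : pretwist T z%:M = 0.
Proof.
rewrite /pretwist mxE eqxx mulr1n block_const block_mxKur block_mxKdl block_mxKdr.
by rewrite subrr !mul0mx mulmx0 oppr0 block_mx0.
Qed.

Lemma pretwistDscalar T z X : pretwist T (z%:M + X) = pretwist T X.
Proof. by rewrite linearD /= pretwist_scalar add0r. Qed.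

Lemma pretwist_traceless T X : pretwist T (traceless X) = pretwist T X.
Proof. by rewrite /traceless linearB /= pretwist_scalar subr0. Qed.

(** Modulo scalars the corner entry may be taken to be 0. As [pretwist] and [bracket] do not see
    scalars, this normal form reduces their identities to computations on [r], [c], [A]. *)
Lemma blockE X : exists r c A, X = (X 0 0)%:M + block_mx 0 r c A.
Proof.
exists (ursubmx X), (dlsubmx X), (drsubmx X - (X 0 0)%:M).
rewrite block_const add_block_mx !add0r addr0 addrC subrK.
rewrite -[LHS]submxK; congr block_mx.
by apply/matrixP => i j; rewrite !ord1 !mxE mulr1n; congr (X _ _); apply/val_inj.
Qed.

Lemma pretwist_block T d r c A :
  pretwist T (block_mx d r c A) = block_mx 0 (r *m T) (- (T *m c)) ((A - (d 0 0)%:M) *m T).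
Proof.
rewrite /pretwist block_mxKur block_mxKdl block_mxKdr; congr (block_mx _ _ _ ((_ - _) *m _)).
have -> : (0 : 'I_(1 + q)) = lshift q (0 : 'I_1) by apply/val_inj.
by rewrite block_mxEul.
Qed.

Lemma pretwist_block0 T r c A :
  pretwist T (block_mx 0 r c A) = block_mx 0 (r *m T) (- (T *m c)) (A *m T).
Proof.
have z0 : (0 : 'M[F]_1) 0 0 = 0 by rewrite mxE.
by rewrite pretwist_block z0 raddf0 subr0.
Qed.

(** On the normal form, [T] acts twice on the right of [r] and [A], and twice on the left of [c],
    where the two signs cancel. *)
Lemma pretwist_sqr T (e : F) X : T *m T = e%:M ->
  pretwist T (pretwist T X) = e *: (X - (X 0 0)%:M).
Proof.
move=> TT; have [r [c [A XE]]] := blockE X.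
have -> : X - (X 0 0)%:M = block_mx 0 r c A by rewrite {1}XE addrC addKr.
rewrite {1}XE linearD /= pretwist_scalar add0r.
rewrite (pretwist_block0 T r c A) pretwist_block0 scale_block_mx mulmxN opprK -!mulmxA TT.
by rewrite mulmxA TT !mul_mx_scalar mul_scalar_mx scaler0.
Qed.

Lemma bracket_block (r s : 'rV[F]_q) (c d : 'cV[F]_q) A B :
  bracket (block_mx 0 r c A) (block_mx 0 s d B) =
  block_mx (r *m d - s *m c) (r *m B - s *m A) (A *m d - B *m c)
    (c *m s - d *m r + A *m B - B *m A).
Proof.
rewrite /bracket !mulmx_block !mul0mx !mulmx0 !add0r opp_block_mx add_block_mx.
by rewrite opprD [X in block_mx _ _ _ X]addrACA !addrA.
Qed.

(** Scalars drop out, so both matrices may be put in normal form and the four blocks compared. In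
    the upper left block the last two terms contribute nothing, and the sign in [- (T *m c)] makes
    the first bracket equal to [- e] times the second. *)
Lemma pretwist_nijenhuis T (e : F) X Y : T *m T = e%:M ->
  bracket (pretwist T X) (pretwist T Y) + e *: bracket X Y
  - pretwist T (bracket (pretwist T X) Y) - pretwist T (bracket X (pretwist T Y)) = 0.
Proof.
move=> TT; have [r [c [A ->]]] := blockE X; have [s [d [B ->]]] := blockE Y.
rewrite !pretwistDscalar.
rewrite !bracketDl !bracketDr !bracket_scalarl !bracket_scalarr !add0r.
rewrite !(pretwist_block0 T r c A) !(pretwist_block0 T s d B).
rewrite !bracket_block !pretwist_block.
rewrite scale_block_mx !opp_block_mx !add_block_mx -[RHS]block_mx0.
have mTT m (M : 'M[F]_(m, q)) : M *m T *m T = e *: M.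
  by rewrite -mulmxA TT mul_mx_scalar.
have TTm m (M : 'M[F]_(q, m)) : T *m T *m M = e *: M.
  by rewrite TT mul_scalar_mx.
congr block_mx.
all: rewrite ?(mulmxDl, mulmxDr, mulmxN, mulNmx, mulmxA, mTT, TTm) -?scalemxAl.
- by apply/matrixP => i j; move: (r *m d) (s *m c) => x y; rewrite !mxE; ring.
- move: (r *m T *m B *m T) (s *m T *m A *m T) (r *m B) (s *m A) => x y z w.
  by apply/matrixP => i j; rewrite !mxE; ring.
- move: (T *m A *m T *m d) (T *m B *m T *m c) (A *m d) (B *m c) => x y z w.
  by apply/matrixP => i j; rewrite !mxE; ring.
(* The corner entries of the last two brackets are opposite, so the scalars that [pretwist]
   subtracts in the lower right block cancel. *)
- have -> : ((- (r *m T *m d) - s *m T *m c) 0 0)%:M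
      = - ((r *m T *m d - - (s *m T *m c)) 0 0)%:M :> 'M[F]_q.
    move: (r *m T *m d) (s *m T *m c) => x y; apply/matrixP => i j.
    by rewrite !mxE opprK -mulNrn opprD.
  rewrite mulNmx.
  move: (_%:M *m T) (T *m c *m s *m T) (T *m d *m r *m T) (A *m T *m B *m T)
    (B *m T *m A *m T) (c *m s) (d *m r) (A *m B) (B *m A) => x1 x2 x3 x4 x5 x6 x7 x8 x9.
  by apply/matrixP => i j; rewrite !mxE; ring.
Qed.

Lemma twist_traceless T X : twist T (traceless X) = twist T X.
Proof. by rewrite /twist pretwist_traceless. Qed.

Lemma twist_sqr T (e : F) X : T *m T = e%:M -> \tr X = 0 ->
  twist T (twist T X) = e *: X.
Proof.
move=> TT X0; rewrite {2}/twist twist_traceless /twist (pretwist_sqr _ TT) linearZ linearB /=.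
by rewrite traceless_scalar subr0 traceless_id.
Qed.

(** [twist] and [pretwist] differ by scalars, which [bracket] ignores, and commutators are already
    trace free; so this is the image under [traceless] of the identity for [pretwist]. *)
Lemma twist_nijenhuis T (e : F) X Y : T *m T = e%:M ->
  bracket (twist T X) (twist T Y) + e *: bracket X Y
  - twist T (bracket (twist T X) Y) - twist T (bracket X (twist T Y)) = 0.
Proof.
move=> TT; have twistE Z : exists z, twist T Z = z%:M + pretwist T Z.
  by exists (- (\tr (pretwist T Z) / (1 + q)%:R)); rewrite raddfN addrC.
have [x xE] := twistE X; have [y yE] := twistE Y; rewrite xE yE.
rewrite !bracketDl !bracketDr !bracket_scalarl !bracket_scalarr !add0r.
have linE (f : {linear 'M[F]_(1 + q) -> 'M[F]_(1 + q)}) U V W Z :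
    f (U + e *: V - W - Z) = f U + e *: f V - f W - f Z.
  by rewrite linearB linearB linearD linearZ.
have := congr1 traceless (pretwist_nijenhuis X Y TT).
rewrite (linE traceless) /= [traceless 0]raddf0.
rewrite (traceless_id (tr_bracket (pretwist T X) (pretwist T Y))).
by rewrite (traceless_id (tr_bracket X Y)).
Qed.

Lemma twist_anticomm T S X : T *m S = - (S *m T) ->
  twist T (twist S X) = - twist S (twist T X).
Proof.
move=> TS; rewrite {2 4}/twist !twist_traceless /twist -linearN /=; congr traceless.
have [r [c [A ->]]] := blockE X; rewrite !pretwistDscalar.
rewrite !(pretwist_block0 _ r c A) pretwist_block0 (pretwist_block0 S) opp_block_mx.
have ST : S *m T = - (T *m S) by rewrite TS opprK.
congr block_mx; first by rewrite oppr0.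
- by rewrite -!mulmxA ST mulmxN.
- by rewrite !mulmxN !opprK !mulmxA TS mulNmx.
- by rewrite -!mulmxA ST mulmxN.
Qed.

End Twist.

(** * Calculus of C^k maps between real normed spaces *)

Section CkTheory.
Context {R : realType} {V : normedModType R}.
Implicit Types (W : normedModType R) (U : set V) (k : nat).

Lemma open_near_eq W U (f g : V -> W) x : open U -> U x ->
  (forall y, U y -> f y = g y) -> \near x, f x = g x.
Proof. by move=> oU Ux fg; exact: filterS (open_nbhs_nbhs (conj oU Ux)). Qed.

(** The difference [g - f] vanishes near [x], so it is differentiable there with differential 0, and
    [g] is the sum of it and [f]. *)
Lemma near_eq_differentiable W (f g : V -> W) x :
  (\near x, f x = g x) -> differentiable f x -> differentiable g x.
Proof.
move=> fg df.
have fg0 : \forall y \near (0 : V), f (y + x) = g (y + x).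
  rewrite (near_shift x (0 : V)) /=; near=> y.
  by rewrite /= sub0r subrK; near: y.
have gf0 : (g - f) x = 0 by rewrite !fctE (nbhs_singleton fg) subrr.
have fgx : (g - f) \o shift x = cst ((g - f) x) + (\0 : V -> W) +o_ 0 id.
  apply/eqaddoP => e e0; near=> y.
  suff -> : ((g - f) \o shift x - (cst ((g - f) x) + (\0 : V -> W))) y = 0.
    by rewrite normr0 mulr_ge0// ltW.
  rewrite gf0 !fctE /= addr0 subr0; suff -> : f (y + x) = g (y + x) by rewrite subrr.
  by near: y.
have d0 : 'd (g - f) x = \0 :> (V -> W) by apply: diff_unique => //; exact: cst_continuous.
suff dgf : differentiable (g - f) x.
  by rewrite -[g](subrK f); exact: differentiableD.
by apply/diff_locallyP; rewrite d0; split => //; exact: cst_continuous.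
Unshelve. all: by end_near. Qed.

Lemma Ck_eq W U k (f g : V -> W) : open U -> (forall y, U y -> f y = g y) ->
  Ck k U f -> Ck k U g.
Proof.
move=> oU; elim: k f g => [|k IH] f g fg /=.
  move=> cf x Ux.
  have H := open_near_eq oU Ux fg.
  have E : f x = g x := fg _ Ux; have := cf x Ux.
  by rewrite /prop_for /continuous_at E; apply: cvg_trans; exact: near_eq_cvg.
move=> [df Df]; split => [x Ux|v].
  by apply: near_eq_differentiable (df x Ux); exact: open_near_eq fg.
apply: IH (Df v) => x Ux; have [->|v0] := eqVneq v 0; first by rewrite !derive0.
by apply: near_eq_derive => //; exact: open_near_eq fg.
Qed.

Lemma Ck_sub W U U' k (f : V -> W) : U' `<=` U -> Ck k U f -> Ck k U' f.
Proof.
move=> sU; elim: k f => [|k IH] f /=; first by move=> cf x /sU; exact: cf.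
by case=> df Df; split=> [x /sU|v]; [exact: df|exact: IH].
Qed.

Lemma CkS W U k (f : V -> W) : Ck k.+1 U f -> Ck k U f.
Proof.
elim: k f => [|k IH] f /= [df Df].
  by move=> x Ux; exact/differentiable_continuous/df.
by split=> // v; exact: IH.
Qed.

Lemma Ck_cst W U k (a : W) : Ck k U (fun=> a).
Proof.
elim: k a => [|k IH] a /=; first by move=> x _; exact: cst_continuous.
split=> [x _|v]; first exact: differentiable_cst.
suff -> : (fun x : V => 'D_v (fun=> a) x) = (fun=> 0) by exact: IH.
by apply/funext => x; rewrite derive_cst.
Qed.

Lemma derive_lin W (f : {linear V -> W}) x v : continuous f -> 'D_v f x = f v.
Proof.
move=> cf; rewrite deriveE ?diff_lin//; exact: linear_differentiable.
Qed.

Lemma Ck_lin W U k (f : {linear V -> W}) : continuous f -> Ck k U f.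
Proof.
case: k => [|k] cf /=; first by move=> x _; exact: cf.
split=> [x _|v]; first exact: linear_differentiable.
suff -> : (fun x : V => 'D_v f x) = (fun=> f v) by exact: Ck_cst.
by apply/funext => x; rewrite derive_lin.
Qed.

(** The directional derivatives of the composite are [L] composed with those of [f], so the
    induction closes without a general chain rule for [Ck]. *)
Lemma Ck_linear_comp W W' U k (L : {linear W -> W'}) (f : V -> W) :
  open U -> continuous L -> Ck k U f -> Ck k U (fun x => L (f x)).
Proof.
move=> oU cL; elim: k f => [|k IH] f /=.
  by move=> cf x Ux; apply: continuous_comp; [exact: cf|exact: cL].
case=> df Df; split=> [x Ux|v].
  by apply: (differentiable_comp (g := L)); [exact: df|exact: linear_differentiable].
apply: (Ck_eq _ _ (IH _ (Df v))) => // x Ux /=.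
have dL : differentiable L (f x) by exact: linear_differentiable.
rewrite [RHS]deriveE; last by apply: (differentiable_comp (g := L)) => //; exact: df.
rewrite (diff_comp (g := L)) ?diff_lin//; last exact: df.
by rewrite /= deriveE//; exact: df.
Qed.

Lemma CkD W U k (f g : V -> W) : open U -> Ck k U f -> Ck k U g ->
  Ck k U (fun x => f x + g x).
Proof.
move=> oU; elim: k f g => [|k IH] f g /=.
  by move=> cf cg x Ux; apply: continuousD; [exact: cf|exact: cg].
move=> [df Df] [dg Dg]; split=> [x Ux|v].
  by apply: differentiableD; [exact: df|exact: dg].
apply: (Ck_eq oU _ (IH _ _ (Df v) (Dg v))) => x Ux /=.
by rewrite deriveD//; apply: diff_derivable; [exact: df|exact: dg].
Qed.

Lemma CkM U k (f g : V -> R) : open U -> Ck k U f -> Ck k U g ->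
  Ck k U (fun x => f x * g x).
Proof.
move=> oU; elim: k f g => [|k IH] f g /=.
  by move=> cf cg x Ux; apply: continuousM; [exact: cf|exact: cg].
(* The product rule keeps one factor undifferentiated, so the induction needs [f] and [g] themselves
   to be C^k. *)
move=> Cf Cg; have := CkS Cf; have := CkS Cg; move: Cf Cg.
move=> [df Df] [dg Dg] Cg Cf; split=> [x Ux|v].
  by apply: differentiableM; [exact: df|exact: dg].
apply: (Ck_eq oU _ (CkD oU (IH _ _ Cf (Dg v)) (IH _ _ Cg (Df v)))) => x Ux /=.
by rewrite deriveM//; apply: diff_derivable; [exact: df|exact: dg].
Qed.

Lemma CkV U k (f : V -> R) : open U -> (forall x, U x -> f x != 0) ->
  Ck k U f -> Ck k U (fun x => (f x)^-1).
Proof.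
move=> oU f0; elim: k => [|k IH] /=.
  by move=> cf x Ux; apply: continuousV; [exact: f0|exact: cf].
move=> Cf; have {IH}IH := IH (CkS Cf); case: Cf => df Df; split=> [x Ux|v].
  by apply: differentiableV; [exact: df|exact: f0].
(* The derivative of the inverse, written as the product of -1, two factors [(f x)^-1] and
   ['D_v f x], is C^k by the induction hypothesis. *)
have Q := CkM oU (CkM oU (CkM oU (Ck_cst U k (-1 : R)) IH) IH) (Df v).
apply: (Ck_eq oU _ Q) => x Ux /=.
rewrite deriveV//; [|exact: f0|by apply: diff_derivable; exact: df].
by rewrite -exprVn expr2 !mulN1r -mulNr.
Qed.

End CkTheory.

(** * Smoothness of complex-valued and matrix-valued maps through real and imaginary parts *)

Section ComplexParts.
Context {R : rcfType}.
Implicit Types z w : R[i].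

Lemma cReD z w : complex.Re (z + w) = complex.Re z + complex.Re w.
Proof. by case: z; case: w. Qed.
Lemma cImD z w : complex.Im (z + w) = complex.Im z + complex.Im w.
Proof. by case: z; case: w. Qed.
Lemma cReM z w : complex.Re (z * w) =
  complex.Re z * complex.Re w - complex.Im z * complex.Im w.
Proof. by case: z; case: w. Qed.
Lemma cImM z w : complex.Im (z * w) =
  complex.Re z * complex.Im w + complex.Im z * complex.Re w.
Proof. by case: z; case: w. Qed.
Lemma cReV z : complex.Re z^-1 =
  complex.Re z / (complex.Re z * complex.Re z + complex.Im z * complex.Im z).
Proof. by case: z => a b; rewrite -!expr2. Qed.
Lemma cImV z : complex.Im z^-1 =
  - (complex.Im z / (complex.Re z * complex.Re z + complex.Im z * complex.Im z)).
Proof. by case: z => a b; rewrite -!expr2. Qed.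
Lemma normsq_neq0 z : z != 0 ->
  complex.Re z * complex.Re z + complex.Im z * complex.Im z != 0.
Proof.
case: z => a b; rewrite eq_complex /= negb_and -!expr2 => ab0.
by rewrite paddr_eq0 ?sqr_ge0// !sqrf_eq0 negb_and.
Qed.

End ComplexParts.

Section ComplexSmooth.
Context {R : realType} {V : normedModType R}.
Implicit Types (U : set V) (f g : V -> R[i]).

Definition csmooth U f :=
  Cinf U (fun x => complex.Re (f x)) /\ Cinf U (fun x => complex.Im (f x)).

Lemma csmooth_cst U z : csmooth U (fun=> z).
Proof. by split=> k; exact: Ck_cst. Qed.

Lemma csmoothD U f g : open U -> csmooth U f -> csmooth U g ->
  csmooth U (fun x => f x + g x).
Proof.
move=> oU [rf jf] [rg jg]; split=> k; under eq_fun do rewrite ?cReD ?cImD;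
  exact: CkD.
Qed.

Lemma csmoothM U f g : open U -> csmooth U f -> csmooth U g ->
  csmooth U (fun x => f x * g x).
Proof.
move=> oU [rf jf] [rg jg]; split=> k; under eq_fun do rewrite ?cReM ?cImM.
  under eq_fun do rewrite -mulN1r.
  by apply: CkD => //; [|apply: CkM; first by []; first exact: Ck_cst]; exact: CkM.
by apply: CkD => //; exact: CkM.
Qed.

Lemma csmoothV U f : open U -> (forall x, U x -> f x != 0) -> csmooth U f ->
  csmooth U (fun x => (f x)^-1).
Proof.
move=> oU f0 [rf jf].
have nf k : Ck k U (fun x => (complex.Re (f x) * complex.Re (f x)
    + complex.Im (f x) * complex.Im (f x))^-1).
  by apply: CkV => // [x /f0/normsq_neq0//|]; apply: CkD => //; exact: CkM.
split=> k; under eq_fun do rewrite ?cReV ?cImV.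
  exact: CkM.
under eq_fun do rewrite -mulN1r.
by apply: CkM => //; [exact: Ck_cst|exact: CkM].
Qed.

Lemma csmooth_sum (I : Type) (r : seq I) (P : pred I) U (F : I -> V -> R[i]) :
  open U -> (forall i, csmooth U (F i)) ->
  csmooth U (fun x => \sum_(i <- r | P i) F i x).
Proof.
move=> oU sF; elim: r => [|i r IH].
  by under eq_fun do rewrite big_nil; exact: csmooth_cst.
under eq_fun do rewrite big_cons; case: (P i) => //; exact: csmoothD.
Qed.

Lemma csmooth_prod (I : Type) (r : seq I) (P : pred I) U (F : I -> V -> R[i]) :
  open U -> (forall i, csmooth U (F i)) ->
  csmooth U (fun x => \prod_(i <- r | P i) F i x).
Proof.
move=> oU sF; elim: r => [|i r IH].
  by under eq_fun do rewrite big_nil; exact: csmooth_cst.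
under eq_fun do rewrite big_cons; case: (P i) => //; exact: csmoothM.
Qed.

Definition mxsmooth m n U (F : V -> 'M[R[i]]_(m, n)) :=
  forall i j, csmooth U (fun x => F x i j).

Lemma mxsmooth_cst m n U (A : 'M[R[i]]_(m, n)) : mxsmooth U (fun=> A).
Proof. by move=> i j; exact: csmooth_cst. Qed.

Lemma mxsmoothD m n U (F G : V -> 'M[R[i]]_(m, n)) : open U ->
  mxsmooth U F -> mxsmooth U G -> mxsmooth U (fun x => F x + G x).
Proof.
by move=> oU sF sG i j; under eq_fun do rewrite mxE; exact: csmoothD.
Qed.

Lemma mxsmoothM m n p U (F : V -> 'M[R[i]]_(m, n)) (G : V -> 'M[R[i]]_(n, p)) :
  open U -> mxsmooth U F -> mxsmooth U G -> mxsmooth U (fun x => F x *m G x).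
Proof.
move=> oU sF sG i j; under eq_fun do rewrite mxE.
by apply: csmooth_sum => // k; exact: csmoothM.
Qed.

(** The coefficients do not depend on [A], so smoothness and derivatives of [phi (F x)] follow from
    the rules for sums and products. *)
Lemma linear_mx_entry m n p q (phi : {linear 'M[R[i]]_(m, n) -> 'M[R[i]]_(p, q)})
    A i j :
  phi A i j = \sum_k \sum_l A k l * phi (delta_mx k l) i j.
Proof.
rewrite [in LHS](matrix_sum_delta A) linear_sum summxE; apply: eq_bigr => k _.
by rewrite linear_sum summxE; apply: eq_bigr => l _; rewrite linearZ mxE.
Qed.

Lemma mxsmooth_lin m n p q (phi : {linear 'M[R[i]]_(m, n) -> 'M[R[i]]_(p, q)})
    U (F : V -> 'M[R[i]]_(m, n)) :
  open U -> mxsmooth U F -> mxsmooth U (fun x => phi (F x)).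
Proof.
move=> oU sF i j; under eq_fun do rewrite linear_mx_entry.
apply: csmooth_sum => // k; apply: csmooth_sum => // l.
by apply: csmoothM => //; exact: csmooth_cst.
Qed.

Lemma csmooth_det n U (F : V -> 'M[R[i]]_n) : open U -> mxsmooth U F ->
  csmooth U (fun x => \det (F x)).
Proof.
move=> oU sF; rewrite /determinant; apply: csmooth_sum => // s.
by apply: csmoothM => //; [exact: csmooth_cst|exact: csmooth_prod].
Qed.

Lemma mxsmooth_adj n U (F : V -> 'M[R[i]]_n) : open U -> mxsmooth U F ->
  mxsmooth U (fun x => \adj (F x)).
Proof.
move=> oU sF i j; under eq_fun do rewrite mxE /cofactor.
apply: csmoothM => //; first exact: csmooth_cst.
apply: csmooth_det => // k l; under eq_fun do rewrite !mxE; exact: sF.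
Qed.

End ComplexSmooth.

(** * Directional derivatives of complex-valued maps, up to Jacobi's formula for determinants *)

Section ComplexDerive.
Context {R : realType} {V : normedModType R}.
Implicit Types (x v : V) (f g : V -> R[i]).

Definition has_cderive x v f (df : R[i]) :=
  is_derive x v (fun y => complex.Re (f y)) (complex.Re df) /\
  is_derive x v (fun y => complex.Im (f y)) (complex.Im df).

Lemma has_cderive_unique x v f df df' :
  has_cderive x v f df -> has_cderive x v f df' -> df = df'.
Proof.
move=> [[_ rf] [_ jf]] [[_ rf'] [_ jf']].
by apply/eqP; rewrite eq_complex -rf -jf rf' jf' !eqxx.
Qed.

Lemma has_cderive_cst x v z : has_cderive x v (fun=> z) 0.
Proof. by split; exact: is_derive_cst. Qed.

Lemma has_cderiveD x v f g df dg : has_cderive x v f df ->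
  has_cderive x v g dg -> has_cderive x v (fun y => f y + g y) (df + dg).
Proof.
move=> [rf jf] [rg jg]; split; under eq_fun do rewrite ?cReD ?cImD;
  rewrite ?cReD ?cImD; exact: is_deriveD.
Qed.

Lemma has_cderiveM x v f g df dg : has_cderive x v f df ->
  has_cderive x v g dg ->
  has_cderive x v (fun y => f y * g y) (df * g x + f x * dg).
Proof.
move=> [rf jf] [rg jg]; split; under eq_fun do rewrite ?cReM ?cImM;
  rewrite ?(cReD, cImD) ?(cReM, cImM).
  apply: (is_derive_eq (is_deriveB (is_deriveM rf rg) (is_deriveM jf jg))).
  by rewrite /GRing.scale/=; ring.
apply: (is_derive_eq (is_deriveD (is_deriveM rf jg) (is_deriveM jf rg))).
by rewrite /GRing.scale/=; ring.
Qed.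

Lemma has_cderive_sum (I : Type) (r : seq I) (P : pred I) x v
    (F : I -> V -> R[i]) dF : (forall i, has_cderive x v (F i) (dF i)) ->
  has_cderive x v (fun y => \sum_(i <- r | P i) F i y) (\sum_(i <- r | P i) dF i).
Proof.
move=> sF; elim: r => [|i r IH].
  by rewrite big_nil; under eq_fun do rewrite big_nil; exact: has_cderive_cst.
rewrite big_cons; under eq_fun do rewrite big_cons; case: (P i) => //.
exact: has_cderiveD.
Qed.

Lemma has_cderive_prod (I : finType) x v
    (F : I -> V -> R[i]) dF : (forall i, has_cderive x v (F i) (dF i)) ->
  has_cderive x v (fun y => \prod_i F i y)
    (\sum_k \prod_i if i == k then dF i else F i x).
Proof.
move=> sF.
(* The induction runs over duplicate-free sequences: a repeated index would be differentiated at all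
   its occurrences at once. *)
suff H r : uniq r -> has_cderive x v (fun y => \prod_(i <- r) F i y)
    (\sum_(k <- r) \prod_(i <- r) if i == k then dF i else F i x).
  by have := H _ (index_enum_uniq I).
elim: r => [|j r IH] /=.
  by rewrite big_nil; under eq_fun do rewrite big_nil; move=> _; exact: has_cderive_cst.
move=> /andP[jr /IH{}IH]; under eq_fun do rewrite big_cons.
suff -> : \sum_(k <- j :: r) \prod_(i <- j :: r) (if i == k then dF i else F i x)
  = dF j * \prod_(i <- r) F i x +
    F j x * \sum_(k <- r) \prod_(i <- r) (if i == k then dF i else F i x).
  exact: has_cderiveM.
rewrite big_cons big_cons eqxx; congr (_ * _ + _).
  apply: eq_big_seq => i ir; case: eqP => // ij; by rewrite -ij ir in jr.
rewrite big_distrr /=; apply: eq_big_seq => k kr; rewrite big_cons.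
by case: eqP => // jk; rewrite jk kr in jr.
Qed.

Lemma csmooth_has_cderive U x v f : csmooth U f -> U x ->
  exists df, has_cderive x v f df.
Proof.
move=> [rf jf] Ux.
exists (Complex ('D_v (fun y => complex.Re (f y)) x) ('D_v (fun y => complex.Im (f y)) x)).
split; apply/derivableP/diff_derivable; [have [+ _] := rf 1|have [+ _] := jf 1]; exact.
Qed.

Definition has_mxderive m n x v (F : V -> 'M[R[i]]_(m, n)) (dF : 'M[R[i]]_(m, n)) :=
  forall i j, has_cderive x v (fun y => F y i j) (dF i j).

Lemma has_mxderive_unique m n x v (F : V -> 'M[R[i]]_(m, n)) dF dF' :
  has_mxderive x v F dF -> has_mxderive x v F dF' -> dF = dF'.
Proof.
by move=> h h'; apply/matrixP => i j; exact: has_cderive_unique (h i j) (h' i j).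
Qed.

Lemma has_mxderive_cst m n x v (A : 'M[R[i]]_(m, n)) : has_mxderive x v (fun=> A) 0.
Proof. by move=> i j; rewrite mxE; exact: has_cderive_cst. Qed.

Lemma has_mxderiveD m n x v (F G : V -> 'M[R[i]]_(m, n)) dF dG :
  has_mxderive x v F dF -> has_mxderive x v G dG ->
  has_mxderive x v (fun y => F y + G y) (dF + dG).
Proof.
move=> hF hG i j; rewrite mxE; under eq_fun do rewrite mxE.
exact: has_cderiveD.
Qed.

Lemma has_mxderiveM m n p x v (F : V -> 'M[R[i]]_(m, n)) (G : V -> 'M[R[i]]_(n, p)) dF dG :
  has_mxderive x v F dF -> has_mxderive x v G dG ->
  has_mxderive x v (fun y => F y *m G y) (dF *m G x + F x *m dG).
Proof.
move=> hF hG i j; rewrite !mxE -big_split /=; under eq_fun do rewrite mxE.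
by apply: has_cderive_sum => k; exact: has_cderiveM.
Qed.

Lemma has_mxderive_lin m n p q (phi : {linear 'M[R[i]]_(m, n) -> 'M[R[i]]_(p, q)})
    x v (F : V -> 'M[R[i]]_(m, n)) dF :
  has_mxderive x v F dF -> has_mxderive x v (fun y => phi (F y)) (phi dF).
Proof.
move=> hF i j; rewrite linear_mx_entry; under eq_fun do rewrite linear_mx_entry.
apply: has_cderive_sum => k; apply: has_cderive_sum => l.
rewrite -[X in has_cderive _ _ _ X]addr0 -(mulr0 (F x k l)).
by apply: has_cderiveM => //; exact: has_cderive_cst.
Qed.

(** Jacobi's formula. Differentiating the Leibniz expansion row by row gives the sum over k of the
    determinants of [F x] with row k replaced by that of [dF]. *)
Lemma has_cderive_det n x v (F : V -> 'M[R[i]]_n) dF : has_mxderive x v F dF ->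
  has_cderive x v (fun y => \det (F y)) (\tr (\adj (F x) *m dF)).
Proof.
move=> hF.
(* The summand [0 * _] is the derivative of the constant sign, in the form that [has_cderiveM]
   produces. *)
suff -> : \tr (\adj (F x) *m dF) = \sum_(s : 'S_n) (0 * (\prod_i F x i (s i))
   + (-1) ^+ s * \sum_k \prod_i if i == k then dF i (s i) else F x i (s i)).
  apply: has_cderive_sum => s; apply: has_cderiveM; first exact: has_cderive_cst.
  by apply: has_cderive_prod => i.
under eq_bigr do rewrite mul0r add0r mulr_sumr.
rewrite exchange_big /= mxtrace_mulC /mxtrace; apply: eq_bigr => k _.
(* Expansion along the replaced row k gives the k-th diagonal entry of [dF *m \adj (F x)]: the
   cofactors of this row involve only the other rows, which are those of [F x]. *)
transitivity (\det (\matrix_(i, j) if i == k then dF i j else F x i j)).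
  rewrite (expand_det_row _ k) mxE; apply: eq_bigr => j _.
  rewrite !mxE eqxx /cofactor; congr (_ * (_ * \det _)).
  by apply/matrixP => i l; rewrite !mxE eq_sym (negbTE (neq_lift _ _)).
by apply: eq_bigr => s _; congr (_ * _); apply: eq_bigr => i _; rewrite mxE.
Qed.

Lemma mxsmooth_has_mxderive m n U x v (F : V -> 'M[R[i]]_(m, n)) :
  mxsmooth U F -> U x -> exists dF, has_mxderive x v F dF.
Proof.
move=> sF Ux.
have /choice[d dP] : forall ij : ('I_m * 'I_n)%type, exists df,
    has_cderive x v (fun y => F y ij.1 ij.2) df.
  by move=> ij; exact: csmooth_has_cderive (sF _ _) Ux.
by exists (\matrix_(i, j) d (i, j)) => i j; rewrite mxE; exact: (dP (i, j)).
Qed.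

End ComplexDerive.

(** * Differentials of maps on a submanifold *)

Section TangentDiff.
Context {R : realType} {V W : normedModType R}.
Implicit Types (M : set V) (f F : V -> W) (x v : V).

Lemma derive_along_curve F x v (c : R -> V) : differentiable F x ->
  differentiable c 0 -> c 0 = x -> (c^`())%classic 0 = v ->
  'D_1 (F \o c) 0 = 'D_v F x.
Proof.
move=> dF dc c0 c1; rewrite -c0 in dF *.
rewrite deriveE; last exact: differentiable_comp.
have E : 'D_1 c 0 = 'd c 0 1 by exact: deriveE.
by rewrite diff_comp//= -E -derive1E c1 -deriveE.
Qed.

(** The extension chosen in [tangent_diff] and [F] both agree with [f] on [M], hence along a curve
    in [M] with velocity [v]; their derivatives along this curve are their derivatives in the
    direction [v]. *)
Lemma tangent_diffE M f x v F : M x -> tangent M x v ->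
  local_extension M f x F -> tangent_diff M f x v = 'D_v F x.
Proof.
move=> Mx [c [I [oI I0 Ic cM [c0 c1]]]] FE; rewrite /tangent_diff.
set G := get _; have GE : local_extension M f x G by apply: (getI FE).
have dc : differentiable c 0 by have [+ _] := Ic 1; apply.
have [U [oU Ux UF Ff]] := FE; have [U' [oU' U'x U'G Gf]] := GE.
have dF : differentiable F x by have [+ _] := UF 1; apply.
have dG : differentiable G x by have [+ _] := U'G 1; apply.
rewrite -(derive_along_curve dF dc c0 c1) -(derive_along_curve dG dc c0 c1).
apply: near_eq_derive.
have cc : {for 0, continuous c} by exact: differentiable_continuous.
have nU : \forall t \near 0, U (c t).
  by apply: cc; rewrite c0; exact: open_nbhs_nbhs.
have nU' : \forall t \near 0, U' (c t).
  by apply: cc; rewrite c0; exact: open_nbhs_nbhs.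
have nI : \forall t \near 0, I t by exact: open_nbhs_nbhs.
near=> t; rewrite /= Ff ?Gf//; try (by apply: cM; near: t); by near: t.
Unshelve. all: by end_near. Qed.

End TangentDiff.

(** * Complex matrices as pairs of real matrices *)

Section ComplexMatrices.
Context {R : realType} {n : nat}.
Local Notation C := R[i].
Local Notation cmx := (cmatrix R n).

Lemma to_complexK : cancel (@to_complex R n) (@of_complex R n).
Proof.
by case=> A B; rewrite /of_complex /to_complex/=; congr pair;
  apply/matrixP => i j; rewrite !mxE.
Qed.

Lemma of_complexK : cancel (@of_complex R n) (@to_complex R n).
Proof.
by move=> A; apply/matrixP => i j; rewrite !mxE/=; case: (A i j).
Qed.

Lemma to_complex_linear (a : R) (v w : cmx) :
  to_complex (a *: v + w) = (a%:C)%C *: to_complex v + to_complex w.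
Proof.
by apply/matrixP => i j; rewrite !mxE/=; apply/eqP; rewrite eq_complex /=
  !mul0r subr0 addr0 !eqxx.
Qed.

Lemma of_complex_linear (a : R) (A B : 'M[C]_n) :
  of_complex ((a%:C)%C *: A + B) = a *: of_complex A + of_complex B.
Proof.
by apply: (can_inj to_complexK); rewrite to_complex_linear !of_complexK.
Qed.

Lemma of_complexD (A B : 'M[C]_n) :
  of_complex (A + B) = of_complex A + of_complex B.
Proof. by rewrite -[A]scale1r of_complex_linear !scale1r. Qed.

Lemma of_complex0 : of_complex (0 : 'M[C]_n) = 0.
Proof. by apply: (addrI (of_complex 0)); rewrite -of_complexD !addr0. Qed.

Lemma of_complexZ (a : R) (A : 'M[C]_n) :
  of_complex ((a%:C)%C *: A) = a *: of_complex A.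
Proof.
by rewrite -[_ *: A]addr0 of_complex_linear of_complex0 addr0.
Qed.

Lemma of_complexB (A B : 'M[C]_n) :
  of_complex (A - B) = of_complex A - of_complex B.
Proof.
by apply: (addIr (of_complex B)); rewrite -of_complexD !subrK.
Qed.

(** Coordinates as linear forms, to which [Ck_linear_comp] and [derive_linear_comp] apply. *)
Definition re_entry (i j : 'I_n) (g : cmx) : R := g.1 i j.
Definition im_entry (i j : 'I_n) (g : cmx) : R := g.2 i j.

Lemma re_entry_linear i j : linear (re_entry i j).
Proof. by move=> a v w; rewrite /re_entry /= !mxE. Qed.
Lemma im_entry_linear i j : linear (im_entry i j).
Proof. by move=> a v w; rewrite /im_entry /= !mxE. Qed.
HB.instance Definition _ i j :=
  GRing.isLinear.Build R cmx R _ (re_entry i j) (re_entry_linear i j).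
HB.instance Definition _ i j :=
  GRing.isLinear.Build R cmx R _ (im_entry i j) (im_entry_linear i j).

Lemma continuous_re_entry i j : continuous (re_entry i j).
Proof.
move=> x; apply: (@continuous_comp _ _ _ fst (fun M : 'M[R]_n => M i j)).
  exact: cvg_fst.
exact: coord_continuous.
Qed.
Lemma continuous_im_entry i j : continuous (im_entry i j).
Proof.
move=> x; apply: (@continuous_comp _ _ _ snd (fun M : 'M[R]_n => M i j)).
  exact: cvg_snd.
exact: coord_continuous.
Qed.

Lemma scale_linear (w : cmx) : linear (fun a : R => a *: w).
Proof. by move=> a b c; rewrite scalerDl scalerA. Qed.

Context {V : normedModType R}.

Lemma mxsmooth_to_complex (U : set V) (F : V -> cmx) : open U -> Cinf U F ->
  mxsmooth U (fun x => to_complex (F x)).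
Proof.
move=> oU sF i j; split=> k; under eq_fun do rewrite mxE /=.
  exact: (Ck_linear_comp (L := re_entry i j) oU (@continuous_re_entry i j) (sF k)).
exact: (Ck_linear_comp (L := im_entry i j) oU (@continuous_im_entry i j) (sF k)).
Qed.

(** A sum of real coefficients times fixed vectors: it reduces the smoothness of [of_complex (F x)]
    to that of the real and imaginary parts of the entries. *)
Lemma of_complexE (A : 'M[C]_n) : of_complex A =
  \sum_i \sum_j (complex.Re (A i j) *: ((delta_mx i j, 0) : cmx)
                 + complex.Im (A i j) *: ((0, delta_mx i j) : cmx)).
Proof.
have pairE (x y : 'M[R]_n) : (x, y) = ((x, 0) : cmx) + ((0, y) : cmx).
  by congr pair; rewrite ?addr0 ?add0r.
have suml (I : Type) (r : seq I) (F : I -> 'M[R]_n) :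
    \sum_(i <- r) ((F i, 0) : cmx) = (\sum_(i <- r) F i, 0).
  elim: r => [|i r IH]; first by rewrite !big_nil.
  by rewrite !big_cons IH; congr pair; rewrite addr0.
have sumr (I : Type) (r : seq I) (F : I -> 'M[R]_n) :
    \sum_(i <- r) ((0, F i) : cmx) = (0, \sum_(i <- r) F i).
  elim: r => [|i r IH]; first by rewrite !big_nil.
  by rewrite !big_cons IH; congr pair; rewrite addr0.
have scl a (x : 'M[R]_n) : a *: ((x, 0) : cmx) = (a *: x, 0).
  by congr pair; rewrite scaler0.
have scr a (x : 'M[R]_n) : a *: ((0, x) : cmx) = (0, a *: x).
  by congr pair; rewrite scaler0.
transitivity ((\sum_i \sum_j complex.Re (A i j) *: delta_mx i j,
    \sum_i \sum_j complex.Im (A i j) *: delta_mx i j) : cmx).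
  congr pair; rewrite [LHS]matrix_sum_delta;
  by apply: eq_bigr => i _; apply: eq_bigr => j _; rewrite mxE.
rewrite pairE -suml -sumr -big_split /=; apply: eq_bigr => i _.
rewrite -suml -sumr -big_split /=; apply: eq_bigr => j _.
by rewrite scl scr.
Qed.

Lemma Cinf_of_complex (U : set V) (F : V -> 'M[C]_n) : open U -> mxsmooth U F ->
  Cinf U (fun x => of_complex (F x)).
Proof.
move=> oU sF k; under eq_fun do rewrite of_complexE.
have CkZ (h : V -> R) (w : cmx) : Ck k U h -> Ck k U (fun x => h x *: w).
  move=> Ch; pose L : {linear R -> cmx} :=
    HB.pack (fun a : R => a *: w) (GRing.isLinear.Build R R cmx _ _ (scale_linear w)).
  apply: (Ck_linear_comp (L := L)) => // x; exact: scalel_continuous.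
have Cksum (I : Type) (r : seq I) (G : I -> V -> cmx) : (forall i, Ck k U (G i)) ->
    Ck k U (fun x => \sum_(i <- r) G i x).
  move=> CG; elim: r => [|i r IH].
    by under eq_fun do rewrite big_nil; exact: Ck_cst.
  by under eq_fun do rewrite big_cons; exact: CkD.
apply: (Cksum) => i; apply: (Cksum) => j; have [rF jF] := sF i j.
by apply: CkD => //; apply: CkZ.
Qed.

Lemma derive_linear_comp (W W' : normedModType R) (L : {linear W -> W'})
  (f : V -> W) x v : continuous L -> differentiable f x ->
  is_derive x v (fun y => L (f y)) (L ('D_v f x)).
Proof.
move=> cL df.
have dL : differentiable L (f x) by exact: linear_differentiable.
have dLf : differentiable (L \o f) x by exact: differentiable_comp.
apply: DeriveDef; first exact: diff_derivable.
by rewrite [LHS](deriveE _ dLf) diff_comp// diff_lin//= deriveE.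
Qed.

Lemma has_mxderive_to_complex (F : V -> cmx) x v : differentiable F x ->
  has_mxderive x v (fun y => to_complex (F y)) (to_complex ('D_v F x)).
Proof.
move=> dF i j; split; under eq_fun do rewrite mxE /=; rewrite mxE /=.
  exact: (derive_linear_comp (L := re_entry i j) v (@continuous_re_entry i j) dF).
exact: (derive_linear_comp (L := im_entry i j) v (@continuous_im_entry i j) dF).
Qed.

Lemma derive_of_complex (F : V -> 'M[C]_n) x v dF :
  differentiable (fun y => of_complex (F y)) x -> has_mxderive x v F dF ->
  'D_v (fun y => of_complex (F y)) x = of_complex dF.
Proof.
move=> dof hF; apply: (can_inj to_complexK); rewrite of_complexK.
have := has_mxderive_to_complex v dof.
by under eq_fun do rewrite of_complexK; move/has_mxderive_unique; apply.
Qed.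

End ComplexMatrices.

Lemma near_eq_has_cderive {R : realType} {V : normedModType R} (x v : V)
    (f g : V -> R[i]) df :
  (\near x, f x = g x) -> has_cderive x v f df -> has_cderive x v g df.
Proof.
move=> fg [rf jf]; split.
  by apply: near_eq_is_derive rf; apply: filterS fg => y ->.
by apply: near_eq_is_derive jf; apply: filterS fg => y ->.
Qed.

Lemma has_mxderive_tr {R : realType} {V : normedModType R} n (x v : V)
    (F : V -> 'M[R[i]]_n) dF : has_mxderive x v F dF ->
  has_cderive x v (fun y => \tr (F y)) (\tr dF).
Proof. by move=> hF; apply: has_cderive_sum => i; exact: hF. Qed.

(** * The tangent spaces of the special linear group *)

Section SpecialLinearTangent.
Context {R : realType} {n : nat}.
Local Notation C := R[i].
Local Notation cmx := (cmatrix R n.+1).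
Local Notation G := (SLC R n.+1).
Local Notation "x ^&c" := (to_complex x) (at level 2, format "x ^&c").
Implicit Types (g x v : cmx).

Lemma SLC_mulmx_adj g : G g -> g^&c *m \adj g^&c = 1%:M.
Proof. by move=> Gg; rewrite mul_mx_adj Gg. Qed.

Lemma SLC_mul_adj_mx g : G g -> \adj g^&c *m g^&c = 1%:M.
Proof. by move=> Gg; rewrite mul_adj_mx Gg. Qed.

(** The determinant is constantly 1 along a curve in [SLC], and Jacobi's formula computes its
    derivative at 0. *)
Lemma tangent_SLC_trace g v : tangent G g v -> \tr (\adj g^&c *m v^&c) = 0.
Proof.
move=> [c [I [oI I0 Ic cG [<- <-]]]].
have dc : differentiable c 0 by have [+ _] := Ic 1; apply.
have /has_cderive_det := has_mxderive_to_complex (1 : R) dc; rewrite -derive1E => D.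
apply: (has_cderive_unique D).
apply: near_eq_has_cderive (has_cderive_cst _ _ 1).
by apply: filterS (open_nbhs_nbhs (conj oI I0)) => t /cG.
Qed.

Lemma csmooth_real_complex (U : set R) : csmooth U (fun t : R => (t%:C)%C).
Proof.
split=> k /=; last exact: Ck_cst.
by apply: (@Ck_lin R R R U k idfun) => x.
Qed.

Lemma has_cderive_real_complex (t : R) : has_cderive t 1 (fun t : R => (t%:C)%C) 1.
Proof. by split=> /=; [exact: is_derive_id|exact: is_derive_cst]. Qed.

Lemma tangent_SLC_mul g (X : 'M[C]_n.+1) : G g -> \tr X = 0 ->
  tangent G g (of_complex (g^&c *m X)).
Proof.
move=> Gg trX.
(* Dividing a column of 1 + t X by the determinant d t gives a curve in SLC; the
   derivative e of 1 / d at 0 is found to vanish by applying tangent_SLC_trace to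
   this very curve. *)
pose A (t : R) : 'M[C]_n.+1 := 1%:M + (t%:C)%C *: X.
pose d t := \det (A t).
pose D t : 'M[C]_n.+1 := diag_mx (\row_j if j == ord0 then (d t)^-1 else 1).
pose I : set R := [set t | d t != 0].
have sA U : open U -> mxsmooth U A.
  move=> oU; apply: mxsmoothD => //; first exact: mxsmooth_cst.
  move=> i j; under eq_fun do rewrite mxE.
  by apply: csmoothM => //; [exact: csmooth_real_complex|exact: csmooth_cst].
have sd U : open U -> csmooth U d by move=> oU; apply: csmooth_det => //; exact: sA.
have oI : open I.
  have [rd jd] := sd _ openT.
  (* The squared modulus of [d] is real and continuous with the same zeros as [d], so [I] is the
     preimage of an open set. *)
  pose N t := complex.Re (d t) * complex.Re (d t) + complex.Im (d t) * complex.Im (d t).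
  have cN : continuous N.
    move=> t; have := CkD openT (CkM openT (rd 0) (rd 0)) (CkM openT (jd 0) (jd 0)).
    by apply.
  have -> : I = N @^-1` [set r | r != 0].
    apply/seteqP; split=> t /=; first exact: normsq_neq0.
    by apply: contra_neq; rewrite /N => ->; rewrite /= mul0r addr0.
  by apply: open_comp => [t _|]; [exact: cN|exact: open_neq].
have A0 : A 0 = 1%:M by rewrite /A scale0r addr0.
have d0 : d 0 = 1 by rewrite /d A0 det1.
have D0 : D 0 = 1%:M.
  apply/matrixP => i j; rewrite !mxE d0 invr1; by case: (i == _).
have I0 : I 0 by rewrite /I /= d0 oner_neq0.
have sdV : csmooth I (fun t => (d t)^-1) by apply: csmoothV => //; exact: sd.
have sD : mxsmooth I D.
  move=> i j; under eq_fun do rewrite !mxE.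
  case: (i == j); case: (i == ord0) => //=; exact: csmooth_cst.
have [e he] := csmooth_has_cderive (1 : R) sdV I0.
have hD : has_mxderive (0 : R) (1 : R) D (e *: delta_mx ord0 ord0).
  move=> i j; under eq_fun do rewrite !mxE; rewrite !mxE.
  have [<-|ij] := eqVneq i j; have [i0|i0] /= := eqVneq i ord0;
    rewrite ?mulr1 ?mulr0 ?mulr0n; try exact: has_cderive_cst.
  - by [].
  - rewrite i0 eq_sym in ij; rewrite (negbTE ij) mulr0; exact: has_cderive_cst.
have hA : has_mxderive (0 : R) (1 : R) A X.
  rewrite -[X]add0r; apply: has_mxderiveD; first exact: has_mxderive_cst.
  move=> i j; under eq_fun do rewrite mxE.
  rewrite -[X in has_cderive _ _ _ X]mul1r -[X in has_cderive _ _ _ X]addr0.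
  rewrite -[X in has_cderive _ _ _ (_ + X)](mulr0 (0%:C)%C).
  apply: has_cderiveM; [exact: has_cderive_real_complex|exact: has_cderive_cst].
pose F t := g^&c *m A t *m D t.
have sF : mxsmooth I F.
  apply: mxsmoothM => //; apply: mxsmoothM => //; first exact: mxsmooth_cst.
  exact: sA.
have hF : has_mxderive (0 : R) (1 : R) F (g^&c *m (X + e *: delta_mx ord0 ord0)).
  have := has_mxderiveM (has_mxderiveM (has_mxderive_cst (0 : R) (1 : R) g^&c) hA) hD.
  by rewrite A0 D0 mul0mx add0r !mulmx1 -mulmxDr.
have sc : Cinf I (fun t => of_complex (F t)) by exact: Cinf_of_complex.
have dc : differentiable (fun t => of_complex (F t)) 0 by have [+ _] := sc 1; apply.
have tan : tangent G g (of_complex (g^&c *m (X + e *: delta_mx ord0 ord0))).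
  exists (fun t => of_complex (F t)), I; split=> //; last split.
  - move=> t It; rewrite /SLC /= of_complexK !det_mulmx Gg mul1r det_diag.
    rewrite (bigD1 ord0)//= mxE eqxx big1 ?mulr1 ?divff// => i i0.
    by rewrite mxE (negbTE i0).
  - by rewrite /F A0 D0 !mulmx1 to_complexK.
  - by rewrite derive1E (derive_of_complex dc hF).
have := tangent_SLC_trace tan.
rewrite of_complexK mulmxA SLC_mul_adj_mx// mul1mx mxtraceD trX add0r mxtraceZ.
have -> : \tr (delta_mx ord0 ord0 : 'M[C]_n.+1) = 1.
  rewrite /mxtrace (bigD1 ord0)//= mxE eqxx big1 ?addr0// => i i0.
  by rewrite mxE (negbTE i0).
by rewrite mulr1 => e0; move: tan; rewrite e0 scale0r addr0.
Qed.

(** As the adjugate is the inverse on [SLC], this identifies the tangent space at [g] with the left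
    translate of the trace free matrices. *)
Lemma tangent_SLCP g v : G g -> tangent G g v <-> \tr (\adj g^&c *m v^&c) = 0.
Proof.
move=> Gg; split; first exact: tangent_SLC_trace.
move=> /(tangent_SLC_mul Gg).
by rewrite mulmxA SLC_mulmx_adj// mul1mx to_complexK.
Qed.

End SpecialLinearTangent.

(** * Smooth maps into products *)

Section CkPair.
Context {R : realType} {V W W' : normedModType R}.

Lemma inl_linear : linear (fun w : W => (w, 0 : W')).
Proof. by move=> a u v; congr pair; rewrite /= scaler0 addr0. Qed.

Lemma inr_linear : linear (fun w : W' => (0 : W, w)).
Proof. by move=> a u v; congr pair; rewrite /= scaler0 addr0. Qed.

(** The pair is a sum of two composites with the linear inclusions of the factors. *)
Lemma Ck_pair U k (f : V -> W) (g : V -> W') : open U -> Ck k U f -> Ck k U g ->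
  Ck k U (fun x => (f x, g x)).
Proof.
move=> oU Cf Cg.
pose L : {linear W -> (W * W')%type} := HB.pack (fun w : W => (w, 0 : W'))
  (GRing.isLinear.Build R W (W * W')%type _ _ inl_linear).
pose L' : {linear W' -> (W * W')%type} := HB.pack (fun w : W' => (0 : W, w))
  (GRing.isLinear.Build R W' (W * W')%type _ _ inr_linear).
have -> : (fun x => (f x, g x)) = (fun x => L (f x) + L' (g x)).
  by apply/funext => x; congr pair; rewrite /= ?addr0 ?add0r.
apply: CkD => //; apply: Ck_linear_comp => // x.
  by apply: cvg_pair; [exact: cvg_id|exact: cvg_cst].
by apply: cvg_pair; [exact: cvg_cst|exact: cvg_id].
Qed.

Lemma Ck_fst U k : Ck k U (fst : W * W' -> W).
Proof. by apply: (@Ck_lin R (W * W')%type W U k fst) => x; exact: cvg_fst. Qed.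

Lemma Ck_snd U k : Ck k U (snd : W * W' -> W').
Proof. by apply: (@Ck_lin R (W * W')%type W' U k snd) => x; exact: cvg_snd. Qed.

End CkPair.

(** * Left trivialization and left invariant fields of endomorphisms *)

Section LeftInvariantField.
Context {R : realType} {n : nat}.
Local Notation C := R[i].
Local Notation cmx := (cmatrix R n.+1).
Local Notation G := (SLC R n.+1).
Local Notation "x ^&c" := (to_complex x) (at level 2, format "x ^&c").
Implicit Types (g x v : cmx) (phi : {linear 'M[C]_n.+1 -> 'M[C]_n.+1}).

(* On SLC the adjugate is the inverse; it makes left_field polynomial. *)
Definition left_field phi (p : cmx * cmx) : cmx * cmx :=
  (p.1, of_complex (p.1^&c *m phi (\adj p.1^&c *m p.2^&c))).

Lemma left_field_mul phi x X : G x ->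
  left_field phi (x, of_complex (x^&c *m X)) = (x, of_complex (x^&c *m phi X)).
Proof.
by move=> Gx; rewrite /left_field /= of_complexK mulmxA SLC_mul_adj_mx// mul1mx.
Qed.

Lemma tangent_SLC_mulP x v : G x -> tangent G x v ->
  exists2 X, \tr X = 0 & v = of_complex (x^&c *m X).
Proof.
move=> Gx /(tangent_SLCP _ Gx) tr0; exists (\adj x^&c *m v^&c) => //.
by rewrite mulmxA SLC_mulmx_adj// mul1mx to_complexK.
Qed.

Lemma mxsmooth_id (U : set cmx) : open U -> mxsmooth U (fun y => y^&c).
Proof.
move=> oU; apply: mxsmooth_to_complex => // k.
by apply: (@Ck_lin R cmx cmx U k idfun) => x; exact: cvg_id.
Qed.

Lemma has_mxderive_id x v : has_mxderive x v (fun y => y^&c) v^&c.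
Proof.
have d : differentiable (fun y : cmx => y) x by exact: ex_diff.
by have := has_mxderive_to_complex v d; rewrite derive_id.
Qed.

(** The trace of [a] vanishes on the whole matrix space, not only on [SLC]: the derivatives of [a]
    are then trace free in every direction, which is where [phi] will square to a scalar. *)
Definition trivialization (X : cmx -> cmx) x (U : set cmx) (a : cmx -> 'M[C]_n.+1) :=
  [/\ open U, U x, mxsmooth U a, forall y, \tr (a y) = 0 &
      forall y, G y -> U y -> X y = of_complex (y^&c *m a y)].

(** If [F] extends [X] near [x], take the trace free part of the adjugate of [y] times [F y]; on
    [SLC] this product is already trace free, because [X] is tangent. *)
Lemma vector_field_trivialization X x : vector_field G X -> G x ->
  exists U a, trivialization X x U a.
Proof.
move=> [sX tX] Gx; have [F [U [oU Ux sF FX]]] := sX _ Gx.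
exists U, (fun y => traceless (\adj y^&c *m (F y)^&c)); split => //.
- apply: (mxsmooth_lin (@traceless C n)) => //; apply: mxsmoothM => //.
    by apply: mxsmooth_adj => //; exact: mxsmooth_id.
  exact: mxsmooth_to_complex.
- by move=> y; exact: tr_traceless.
- move=> y Gy Uy; rewrite FX// traceless_id; last exact/tangent_SLC_trace/tX.
  by rewrite mulmxA SLC_mulmx_adj// mul1mx to_complexK.
Qed.

Lemma trivialization_sub X x U U' a : open U' -> U' x -> U' `<=` U ->
  trivialization X x U a -> trivialization X x U' a.
Proof.
move=> oU' U'x sU [_ _ sa tra aX]; split=> // [i j|y Gy /sU]; last exact: aX.
by have [ra ja] := sa i j; split=> k; apply: Ck_sub sU _.
Qed.

Lemma trivialization_act phi X x U a : (forall Z, \tr (phi Z) = 0) ->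
  trivialization X x U a ->
  trivialization (act_field (left_field phi) X) x U (fun y => phi (a y)).
Proof.
move=> trphi [oU Ux sa tra aX]; split=> //; first exact: mxsmooth_lin.
by move=> y Gy Uy; rewrite /act_field aX// left_field_mul.
Qed.

Lemma trivialization_tangent_diff X x U a v da :
  G x -> tangent G x v -> trivialization X x U a -> has_mxderive x v a da ->
  tangent_diff G X x v = of_complex (v^&c *m a x + x^&c *m da).
Proof.
move=> Gx Tv [oU Ux sa tra aX] ha.
have sF : Cinf U (fun y => of_complex (y^&c *m a y)).
  by apply: Cinf_of_complex => //; apply: mxsmoothM => //; exact: mxsmooth_id.
have LE : local_extension G X x (fun y => of_complex (y^&c *m a y)).
  by exists U; split=> // y Gy Uy; rewrite aX.
rewrite (tangent_diffE Gx Tv LE).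
rewrite (derive_of_complex _ (has_mxderiveM (has_mxderive_id x v) ha))//.
by have [+ _] := sF 1; apply.
Qed.

(** Differentiating [y *m b y] in the direction [X x = x *m a x] gives [x *m (a x *m b x + db)];
    exchanging the roles and subtracting leaves the commutator and the two derivatives. *)
Lemma trivialization_lie_bracket X Y x U a b da db :
  G x -> trivialization X x U a -> trivialization Y x U b ->
  has_mxderive x (Y x) a da -> has_mxderive x (X x) b db ->
  lie_bracket G X Y x = of_complex (x^&c *m (bracket (a x) (b x) + db - da)).
Proof.
move=> Gx fX fY ha hb.
have [_ Ux _ tra /(_ _ Gx Ux) Xx] := fX; have [_ _ _ trb /(_ _ Gx Ux) Yx] := fY.
have TX : tangent G x (X x) by rewrite Xx; exact: tangent_SLC_mul.
have TY : tangent G x (Y x) by rewrite Yx; exact: tangent_SLC_mul.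
rewrite /lie_bracket (trivialization_tangent_diff Gx TX fY hb).
rewrite (trivialization_tangent_diff Gx TY fX ha).
rewrite -of_complexB Xx Yx !of_complexK /bracket -!mulmxA -!mulmxDr -mulmxBr.
by congr (of_complex (_ *m _)); apply/matrixP => i j; move: (a x *m b x) (b x *m a x) => u w;
  rewrite !mxE; ring.
Qed.

Lemma trivialization_derive X x U a v : trivialization X x U a ->
  exists2 da, has_mxderive x v a da & \tr da = 0.
Proof.
move=> [oU Ux sa tra _]; have [da ha] := mxsmooth_has_mxderive v sa Ux.
exists da => //; apply: (has_cderive_unique (has_mxderive_tr ha)).
by under eq_fun do rewrite tra; exact: has_cderive_cst.
Qed.

(** Left multiplication as a real linear map; it carries a basis of sl to bases of the tangent
    spaces. *)
Definition mul_real (A : 'M[C]_n.+1) (v : cmx) : cmx := of_complex (A *m v^&c).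
Lemma mul_real_linear A : linear (mul_real A).
Proof.
by move=> a v w; rewrite /mul_real to_complex_linear mulmxDr -scalemxAr
  of_complex_linear.
Qed.
HB.instance Definition _ A :=
  GRing.isLinear.Build R cmx cmx _ (mul_real A) (mul_real_linear A).

(** * The field of a fixed [phi]: smoothness, square, trace, Nijenhuis tensor, invariance *)

Section Fixed.
Variable phi : {linear 'M[C]_n.+1 -> 'M[C]_n.+1}.
Hypothesis tr_phi : forall X, \tr (phi X) = 0.
Local Notation P := (left_field phi).

Lemma tangent_bundle_left_field p :
  tangent_bundle G p -> tangent_bundle G (P p) /\ (P p).1 = p.1.
Proof.
move=> [Gp Tp]; split=> //; split=> //=.
by apply: tangent_SLC_mul => //; exact: tr_phi.
Qed.

Lemma left_field_smooth : smooth_map (tangent_bundle G) P.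
Proof.
(* [P] is smooth on the whole space, so it is its own extension around every point. *)
move=> p _; exists P, setT; split=> //; first exact: openT.
have oT : open [set: cmx * cmx] by exact: openT.
have s1 : mxsmooth [set: cmx * cmx] (fun p => p.1^&c).
  by apply: mxsmooth_to_complex => // k; exact: Ck_fst.
have s2 : mxsmooth [set: cmx * cmx] (fun p => p.2^&c).
  by apply: mxsmooth_to_complex => // k; exact: Ck_snd.
move=> k; apply: Ck_pair => //; first exact: Ck_fst.
apply: Cinf_of_complex => //; apply: mxsmoothM => //; apply: mxsmooth_lin => //.
by apply: mxsmoothM => //; exact: mxsmooth_adj.
Qed.

Lemma left_field_bundle : bundle_endomorphism G P.
Proof.
split; [exact: left_field_smooth|exact: tangent_bundle_left_field|].
move=> x a v w Gx _ _; rewrite /left_field /= to_complex_linear mulmxDr -scalemxAr.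
by rewrite linearD linearZ /= mulmxDr -scalemxAr of_complex_linear.
Qed.

Lemma left_field_sqr (e : R) :
  (forall X, \tr X = 0 -> phi (phi X) = (e%:C)%C *: X) ->
  forall p, tangent_bundle G p -> P (P p) = (p.1, e *: p.2).
Proof.
move=> phi2 [x v] [/= Gx /(tangent_SLC_mulP Gx)[X X0 ->]].
by rewrite (left_field_mul _ X)// (left_field_mul _ (phi X))// phi2// -scalemxAr of_complexZ.
Qed.

(** Left translation conjugates every fibre to [phi] on sl, so the real trace is the same at each
    point. *)
Lemma left_field_trace : exists t : R, forall x, G x ->
  has_trace (tangent G x) (fun v => (P (x, v)).2) t.
Proof.
pose V := ('M[R]_n.+1 * 'M[R]_n.+1)%type : vectType R.
pose tre (v : V) : (R * R)%type :=
  (complex.Re (\tr (to_complex v)), complex.Im (\tr (to_complex v))).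
have tre_linear : linear tre.
  move=> a v w; rewrite /tre to_complex_linear mxtraceD mxtraceZ.
  by rewrite !cReD !cImD !cReM !cImM /= !mul0r subr0 addr0.
pose T : {linear V -> (R * R)%type} :=
  HB.pack tre (GRing.isLinear.Build R V (R * R)%type _ _ tre_linear).
pose K := lker (linfun T).
have KP (v : V) : reflect (\tr (to_complex v) = 0) (v \in K).
  rewrite memv_ker lfunE /=; apply: (iffP eqP) => [[rv jv]|trv].
    by apply/eqP; rewrite eq_complex rv jv !eqxx.
  by rewrite /tre trv.
pose b := vbasis K.
pose phir (v : V) : V := of_complex (phi (to_complex v)).
pose A := \matrix_(i, j) coord b i (phir b`_j) : 'M[R]_(\dim K).
(* In the basis of [K] translated by [x], the matrix of [P] is [A] whatever [x] is. *)
exists (\tr A) => x Gx; exists (\dim K), (fun i => mul_real x^&c b`_i), A.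
have mulK (v : cmx) : mul_real x^&c (mul_real (\adj x^&c) v) = v.
  by rewrite /mul_real of_complexK mulmxA SLC_mulmx_adj// mul1mx to_complexK.
have Kmul (v : cmx) : mul_real (\adj x^&c) (mul_real x^&c v) = v.
  by rewrite /mul_real of_complexK mulmxA SLC_mul_adj_mx// mul1mx to_complexK.
have mul_sum (c : 'I_(\dim K) -> R) : mul_real x^&c (\sum_i c i *: b`_i)
    = \sum_i c i *: mul_real x^&c b`_i.
  by rewrite linear_sum; apply: eq_bigr => i _; rewrite linearZ.
split=> //; first split.
- move=> v; rewrite tangent_SLCP//; split=> [trv|[c ->]].
    have : (mul_real (\adj x^&c) v : V) \in K.
      by apply/KP; rewrite /mul_real of_complexK.
    move=> /coord_vbasis vE; exists (fun i => coord b i (mul_real (\adj x^&c) v)).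
    by rewrite -mul_sum -vE mulK.
  rewrite -mul_sum /mul_real of_complexK mulmxA SLC_mul_adj_mx// mul1mx.
  by apply/KP/memv_suml => i _; apply: memvZ; apply: vbasis_mem; exact: memt_nth.
- move=> c; rewrite -mul_sum => /(congr1 (mul_real (\adj x^&c))).
  rewrite Kmul linear0 => c0 i.
  by have /freeP := basis_free (vbasisP K); apply.
- move=> j; rewrite /left_field /= of_complexK mulmxA SLC_mul_adj_mx// mul1mx.
  have /coord_vbasis E : phir b`_j \in K by apply/KP; rewrite /phir of_complexK tr_phi.
  have -> : of_complex (x^&c *m phi (to_complex b`_j)) = mul_real x^&c (phir b`_j).
    by rewrite /mul_real /phir of_complexK.
  rewrite E mul_sum; apply: eq_bigr => i _; by rewrite mxE.
Qed.

(** One statement serves both signs: [e] is 1 for product structures and -1 for complex ones. In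
    left trivializations the four brackets split into commutators, covered by the hypothesis on
    [phi], and derivatives of [a] and [b], which cancel. *)
Lemma left_field_nijenhuis (e : R) :
  (forall X, \tr X = 0 -> phi (phi X) = (e%:C)%C *: X) ->
  (forall X Y, bracket (phi X) (phi Y) + (e%:C)%C *: bracket X Y
     - phi (bracket (phi X) Y) - phi (bracket X (phi Y)) = 0) ->
  forall X Y, vector_field G X -> vector_field G Y -> forall x, G x ->
    lie_bracket G (act_field P X) (act_field P Y) x + e *: lie_bracket G X Y x
    - act_field P (lie_bracket G (act_field P X) Y) x
    - act_field P (lie_bracket G X (act_field P Y)) x = 0.
Proof.
move=> phi2 phiN X Y vX vY x Gx.
have [U [a fX]] := vector_field_trivialization vX Gx.
have [U' [b fY]] := vector_field_trivialization vY Gx.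
have [oU Ux _ _ _] := fX; have [oU' U'x _ _ _] := fY.
have oUU : open (U `&` U') by exact: openI.
have {}fX := trivialization_sub oUU (conj Ux U'x) (@subIsetl _ _ _) fX.
have {}fY := trivialization_sub oUU (conj Ux U'x) (@subIsetr _ _ _) fY.
have fPX := trivialization_act tr_phi fX; have fPY := trivialization_act tr_phi fY.
(* The four directional derivatives that occur: [a] along [Y] and [P Y], [b] along [X] and [P X]. *)
have [a1 ha1 tra1] := trivialization_derive (Y x) fX.
have [a2 ha2 tra2] := trivialization_derive (act_field P Y x) fX.
have [b1 hb1 trb1] := trivialization_derive (X x) fY.
have [b2 hb2 trb2] := trivialization_derive (act_field P X x) fY.
have hP v (f : cmx -> 'M[C]_n.+1) df : has_mxderive x v f df ->
  has_mxderive x v (fun y => phi (f y)) (phi df) by exact: has_mxderive_lin.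
rewrite /act_field (trivialization_lie_bracket Gx fPX fPY (hP _ _ _ ha2) (hP _ _ _ hb2)).
rewrite (trivialization_lie_bracket Gx fX fY ha1 hb1).
rewrite (trivialization_lie_bracket Gx fPX fY (hP _ _ _ ha1) hb2).
rewrite (trivialization_lie_bracket Gx fX fPY ha2 (hP _ _ _ hb1)).
rewrite !left_field_mul// -of_complexZ -of_complexD -!of_complexB.
rewrite scalemxAr -mulmxDr -!mulmxBr.
have linE A B D : phi (A + B - D) = phi A + phi B - phi D by rewrite linearB linearD.
(* In the last two terms [phi] is applied twice to [a1] and [b1]; being trace free, they are
   multiplied by [e] and cancel the derivative part of [e] times the bracket of [X] and [Y]. *)
rewrite !linE (phi2 _ tra1) (phi2 _ trb1).
have /(congr1 (fun A => of_complex (x^&c *m A))) := phiN (a x) (b x).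
rewrite mulmx0 of_complex0 => E; apply: etrans E; congr (of_complex (_ *m _)).
move: (bracket (phi _) _) (bracket (a x) (b x)) (phi (bracket _ _))
  (phi (bracket _ _)) => A1 A2 A3 A4.
by move: (phi a2) (phi b2) => A5 A6; apply/matrixP => i j; rewrite !mxE; ring.
Qed.

Lemma left_field_invariant : left_invariant G (@cmul R n.+1) P.
Proof.
move=> h Gh p Tp; have Tp' := tangent_bundle_left_field Tp.
(* Left translation by [h] is linear, hence its own differential. *)
have tmE q : tangent_bundle G q -> tangent_map G (cmul h) q = (cmul h q.1, cmul h q.2).
  move=> [Gq Tq]; congr pair.
  have LE : local_extension G (cmul h) q.1 (cmul h).
    exists setT; split=> //; first exact: openT.
    apply: Cinf_of_complex; first exact: openT.
    apply: mxsmoothM; [exact: openT|exact: mxsmooth_cst|by apply: mxsmooth_id; exact: openT].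
  rewrite (tangent_diffE Gq Tq LE).
  have [U [_ Ux sU _]] := LE.
  have := has_mxderiveM (has_mxderive_cst q.1 q.2 h^&c) (has_mxderive_id q.1 q.2).
  rewrite mul0mx add0r => H; rewrite /cmul (derive_of_complex _ H)//.
  by have [+ _] := sU 1; apply.
have [[Gp _] [Tp1 _]] := (Tp, Tp').
(* In terms of inverses, [(h p)^-1 h = p^-1]: left translation does not change the trivialized
   vector. *)
have adjE : \adj (h^&c *m p.1^&c) *m h^&c = \adj p.1^&c.
  rewrite -[LHS]mulmx1 -(SLC_mulmx_adj Gp) mulmxA -(mulmxA _ h^&c) mul_adj_mx.
  by rewrite det_mulmx Gh Gp mulr1 mul1mx.
rewrite !tmE// /left_field /cmul /= !of_complexK; congr pair.
by rewrite [_ *m (h^&c *m _)]mulmxA adjE mulmxA.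
Qed.

End Fixed.

Lemma left_field_anticomm phi (psi : {linear 'M[C]_n.+1 -> 'M[C]_n.+1}) x v :
  (forall X, phi (psi X) = - psi (phi X)) -> G x -> tangent G x v ->
  (left_field phi (left_field psi (x, v))).2
  = - (left_field psi (left_field phi (x, v))).2.
Proof.
move=> anti Gx /(tangent_SLC_mulP Gx)[X _ ->].
rewrite (left_field_mul psi X)// (left_field_mul phi X)//.
rewrite (left_field_mul phi (psi X))// (left_field_mul psi (phi X))//= anti.
by rewrite mulmxN -sub0r of_complexB of_complex0 sub0r.
Qed.

End LeftInvariantField.

(** * Anticommuting matrices of even size with squares 1 and -1 *)

Section ParaQuaternions.
Context {F : numFieldType} {k : nat}.

Definition para_mx : 'M[F]_(k + k) := block_mx 1%:M 0 0 (- 1%:M).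
Definition cplx_mx : 'M[F]_(k + k) := block_mx 0 (- 1%:M) 1%:M 0.

Lemma para_mx_sqr : para_mx *m para_mx = 1%:M.
Proof.
rewrite /para_mx mulmx_block !mulmx0 !mul0mx !addr0 add0r mulmx1 mulmxN mulmx1 opprK.
by rewrite -scalar_mx_block.
Qed.

Lemma cplx_mx_sqr : cplx_mx *m cplx_mx = (- 1)%:M.
Proof.
rewrite /cplx_mx mulmx_block !mulmx0 !mul0mx !addr0 !add0r mulmx1 mul1mx.
by rewrite (scalar_mx_block _ _ (-1)) raddfN.
Qed.

Lemma para_cplx_anticomm : para_mx *m cplx_mx = - (cplx_mx *m para_mx).
Proof.
rewrite /para_mx /cplx_mx !mulmx_block !mulmx0 !mul0mx !addr0 !add0r !mul1mx.
by rewrite mulmx1 mulNmx mulmxN mul1mx opp_block_mx !opprK !oppr0.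
Qed.

End ParaQuaternions.

(** * The product and complex structures defined by twists *)

Section LeftFieldStructures.
Context {R : realType} {q : nat}.
Local Notation C := R[i].
Local Notation G := (SLC R q.+1).
Implicit Types T : 'M[C]_q.

Definition twist_field T := left_field (twist T).

Lemma twist_field_invariant T : left_invariant G (@cmul R q.+1) (twist_field T).
Proof. exact: left_field_invariant (tr_twist T). Qed.

Lemma twist_field_anticomm T S x v : T *m S = - (S *m T) -> G x -> tangent G x v ->
  (twist_field T (twist_field S (x, v))).2 = - (twist_field S (twist_field T (x, v))).2.
Proof. by move=> TS; apply: left_field_anticomm => X; exact: twist_anticomm. Qed.

Lemma twist_field_product T : T *m T = 1%:M ->
  product_structure G (twist_field T).
Proof.
move=> TT.
have twist2 X : \tr X = 0 -> twist T (twist T X) = (1%:C)%C *: X by exact: twist_sqr.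
have twistN X Y : bracket (twist T X) (twist T Y) + (1%:C)%C *: bracket X Y
    - twist T (bracket (twist T X) Y) - twist T (bracket X (twist T Y)) = 0.
  exact: twist_nijenhuis.
split; first split.
- exact: left_field_bundle (tr_twist T).
- move=> p Gp; rewrite /twist_field (left_field_sqr twist2 Gp) scale1r; by case: p Gp.
- exact: left_field_trace (tr_twist T).
move=> X Y vX vY x Gx.
by have := left_field_nijenhuis (tr_twist T) twist2 twistN vX vY Gx; rewrite scale1r.
Qed.

Lemma twist_field_complex T : T *m T = (-1)%:M ->
  complex_structure G (twist_field T).
Proof.
move=> TT; have N1 : ((-1 : R)%:C)%C = -1 by rewrite rmorphN1.
have twist2 X : \tr X = 0 -> twist T (twist T X) = ((-1 : R)%:C)%C *: X.
  by rewrite N1; exact: twist_sqr.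
have twistN X Y : bracket (twist T X) (twist T Y) + ((-1 : R)%:C)%C *: bracket X Y
    - twist T (bracket (twist T X) Y) - twist T (bracket X (twist T Y)) = 0.
  by rewrite N1; exact: twist_nijenhuis.
split; first split.
- exact: left_field_bundle (tr_twist T).
- by move=> p Gp; rewrite /twist_field (left_field_sqr twist2 Gp) scaleN1r.
move=> X Y vX vY x Gx.
by have := left_field_nijenhuis (tr_twist T) twist2 twistN vX vY Gx; rewrite scaleN1r.
Qed.

End LeftFieldStructures.

Theorem corollary1p2 (R : realType) (m : nat) (hm : (1 < m)%N) :
  let n := (2 * m - 1)%N in
  exists P J : cmatrix R n * cmatrix R n -> cmatrix R n * cmatrix R n,
    complex_product_structure (SLC R n) P J /\
    left_invariant (SLC R n) (@cmul R n) P /\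
    left_invariant (SLC R n) (@cmul R n) J.
Proof.
move=> n.
(* Here n = q + 1 with q = 2 (m - 1) even, as the two-by-two block form of [para_mx] and [cplx_mx]
   requires. *)
have -> : n = (m.-1 + m.-1).+1.
  by rewrite {}/n; case: m hm => // k _; rewrite mul2n -addnn addnS addSn subn1.
exists (twist_field para_mx), (twist_field cplx_mx); split; last first.
  by split; exact: twist_field_invariant.
split.
- exact: twist_field_product para_mx_sqr.
- exact: twist_field_complex cplx_mx_sqr.
- by move=> x v; exact: twist_field_anticomm para_cplx_anticomm.
Qed.
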